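(* Let $X$ be a nonempty set and let $k$ be a finite field of characteristic $2$. Then $k\langle X\rangle$ has infinitely many maximal $T$-spaces.
   Context: $k\langle X\rangle$ denotes the free unitary associative $k$-algebra on $X$. A $T$-space of $k\langle X\rangle$ is a $k$-linear subspace invariant under every (unitary) $k$-algebra endomorphism of $k\langle X\rangle$. A maximal $T$-space is a maximal element, under inclusion, among the proper $T$-spaces. *)

(* Defs.v *)
From mathcomp Require Import all_boot all_algebra.
From mathcomp Require Import finmap.
From mathcomp.multinomials Require Import monalg.
From mathcomp Require Import boolp classical_sets functions cardinality.

Set Implicit Arguments.
Unset Strict Implicit.
Unset Printing Implicit Defensive.

Import GRing.Theory.
Local Open Scope classical_set_scope.
Local Open Scope ring_scope.

(* The algebra of the free monoid on X.  The choiceType requirement on X is no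
   restriction: classically every type carries such a structure ({classic T}). *)
Notation free_algebra k X := {malg k[{fmonom X}]}.

Section TSpaces.
Variables (k : fieldType) (A : lalgType k).

Definition is_subspace (V : set A) : Prop :=
  V 0 /\ forall (a : k) (u v : A), V u -> V v -> V (a *: u + v).

(* {lrmorphism A -> A}: k-linear ring endomorphisms preserving 1. *)
Definition is_Tspace (V : set A) : Prop :=
  is_subspace V /\ forall f : {lrmorphism A -> A}, f @` V `<=` V.

Definition is_maximal_Tspace (V : set A) : Prop :=
  [/\ is_Tspace V, V <> setT &
      forall W : set A, is_Tspace W -> W <> setT -> V `<=` W -> W = V].

End TSpaces.

(* Main.v *)
Require Import Defs.
From HB Require Import structures.
From mathcomp Require Import all_boot all_algebra pgroup all_field.
From mathcomp Require Import finmap.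
From mathcomp.multinomials Require Import monalg.
From mathcomp Require Import boolp classical_sets functions cardinality.

(** Write [q = #|k|] and let [p] be the characteristic of [k].  For each
[N], take the algebra homomorphisms [phi] from the free algebra to a field whose
values lie in the field of [q ^ N] elements, and let [V_N] be the set of those
[f] such that every [phi f] has trace zero over [k], the trace being [y + y ^ q + ... + y ^ (q ^ (N - 1))].
Composing [phi] with an endomorphism gives another such [phi], so [V_N] is a
T-space ([trace_space_Tspace]).

It is proper for [0 < N]: no variable belongs to it, since some element has
trace 1 ([qtrace1_witness]) and all variables can be sent to that element
([gen_notin_trace_space]).

The key point is that the [V_N], for [N] a power of [p], are pairwise
comaximal.  If [M = N * d] with [p] dividing [d], an element of the subfield
with [q ^ N] elements has a trace from level [M] equal to [d] times its trace
from level [N], hence zero.  Choose a one-variable polynomial [f] which, on the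
field with [q ^ M] elements, is the identity on that subfield and zero off it.
Then [f] is in [V_M] and ['X - f], which vanishes on the subfield, is in [V_N];
so [V_M + V_N] contains a variable ([trace_spaces_comaximal]).

A T-space containing a variable is everything, so Zorn's lemma puts every
proper T-space inside a maximal one ([maximal_Tspace_above]).  Maximal T-spaces
above [V_N] and [V_M], for distinct powers [N] and [M] of [p], are distinct by
comaximality, so there are infinitely many. *)

Set Implicit Arguments.
Unset Strict Implicit.
Unset Printing Implicit Defensive.

Import GRing.Theory.
Local Open Scope classical_set_scope.
Local Open Scope ring_scope.

(** * Traces as sums of Frobenius powers *)

(** When [y ^ (q ^ N) = y] this is the trace of [y] from the field with [q ^ N]
elements to the field with [q] elements; as a polynomial expression it makes
sense in any semiring, in particular for the polynomial ['X]. *)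
Definition qtrace (R : pzSemiRingType) (q N : nat) (y : R) : R :=
  \sum_(i < N) y ^+ (q ^ i).

(** The Frobenius powers of [y] repeat with period [N]; thus the larger trace
vanishes as soon as [d] is divisible by the characteristic. *)
Lemma qtrace_mul (R : pzSemiRingType) (q N d : nat) (y : R) :
  y ^+ (q ^ N) = y -> qtrace q (N * d) y = qtrace q N y *+ d.
Proof.
move=> yN.
have y_id j : y ^+ (q ^ (N * j)) = y.
  by elim: j => [|j IHj]; rewrite ?muln0 // mulnS expnD exprM yN.
elim: d => [|d IHd]; first by rewrite muln0 mulr0n /qtrace big_ord0.
rewrite mulnSr mulrSr -IHd /qtrace big_split_ord /=; congr (_ + _).
by apply: eq_bigr => i _; rewrite expnD exprM y_id.
Qed.

Section FiniteBaseField.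
Variable k : finFieldType.
Local Notation q := #|k|.

Lemma pnat_card_finField p : p \in [pchar k] -> p.-nat q.
Proof. by move=> pk; have := pprimeChar_pgroup pk; rewrite /pgroup cardsT. Qed.

Lemma pnat_card_lalg (L : lalgType k) : [pchar L].-nat q.
Proof.
have [p _ pk] := finPcharP k.
rewrite (eq_pnat _ (pchar_lalg L)) (eq_pnat _ (pcharf_eq pk)).
exact: pnat_card_finField.
Qed.

Lemma expf_card_pow (c : k) i : c ^+ (q ^ i) = c.
Proof. by elim: i => [|i IHi] //; rewrite expnS exprM expf_card. Qed.

Section Frobenius.
Variable L : comAlgType k.

Lemma frobeniusD i : {morph (fun y : L => y ^+ (q ^ i)) : u v / u + v}.
Proof. by move=> u v; rewrite exprDn_pchar // pnatX pnat_card_lalg. Qed.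

Lemma frobenius0 i : (0 : L) ^+ (q ^ i) = 0.
Proof. by rewrite expr0n expn_eq0 -leqn0 leqNgt (ltnW (finNzRing_gt1 k)). Qed.

Lemma frobeniusZ i (c : k) (y : L) : (c *: y) ^+ (q ^ i) = c *: y ^+ (q ^ i).
Proof. by rewrite exprZn expf_card_pow. Qed.

Lemma qtrace0 N : qtrace q N (0 : L) = 0.
Proof. by rewrite /qtrace big1 // => i _; rewrite frobenius0. Qed.

Lemma qtrace_linear N (c : k) (u v : L) :
  qtrace q N (c *: u + v) = c *: qtrace q N u + qtrace q N v.
Proof.
rewrite /qtrace scaler_sumr -big_split /=.
by apply: eq_bigr => i _; rewrite frobeniusD frobeniusZ.
Qed.

(** Telescoping: [T ^ q - T = y ^ (q ^ N) - y] for [T] the trace of [y], stated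
without subtraction. *)
Lemma qtrace_frobenius N (y : L) :
  qtrace q N y ^+ q + y = qtrace q N y + y ^+ (q ^ N).
Proof.
have -> : qtrace q N y ^+ q = \sum_(i < N) y ^+ (q ^ i.+1).
  rewrite -[q in LHS]expn1 /qtrace.
  rewrite (big_morph _ (frobeniusD 1) (frobenius0 1)).
  by apply: eq_bigr => i _; rewrite -exprM expn1 expnSr.
transitivity (\sum_(i < N.+1) y ^+ (q ^ i)); last by rewrite big_ord_recr.
by rewrite big_ord_recl addrC.
Qed.

End Frobenius.

(** In a splitting field of [T - 1], where [T] is the trace polynomial, a root
[a] has trace 1; the telescoping identity then yields
[a ^ (q ^ N) - a = 1 ^ q - 1 = 0]. *)
Lemma qtrace1_witness N : (0 < N)%N ->
  exists (L : fieldExtType k) (a : L), a ^+ (q ^ N) = a /\ qtrace q N a = 1.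
Proof.
case: N => // N _.
pose P : {poly k} := qtrace q N.+1 'X - 1.
(* ['X] occurs in [P] only through the term of index 0, so [P] is not constant. *)
have coefP1 : P`_1 = 1.
  rewrite /P /qtrace big_ord_recl coefB coefD coefX coef1 subr0 coef_sum.
  rewrite big1 ?addr0 // => i _; rewrite coefXn /=.
  by rewrite ltn_eqF // -{1}(expn0 q) ltn_exp2l ?finNzRing_gt1.
have szP : (1 < size P)%N.
  rewrite ltnNge; apply/negP => /(nth_default 0); rewrite coefP1.
  by apply/eqP; rewrite oner_eq0.
have nzP : P != 0 by rewrite -size_poly_gt0 ltnW.
have [L [zs DP _]] := FinSplittingFieldFor nzP.
have := eqp_size DP; rewrite size_map_poly size_prod_XsubC.
case: zs DP => [|a zs] DP szE; first by rewrite szE in szP.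
exists L, a.
have : root (map_poly (in_alg L) P) a.
  by rewrite (eqp_root DP) root_prod_XsubC mem_head.
rewrite /P rmorphB rmorph1 /= /qtrace rmorph_sum /= rootE hornerD hornerN hornerC.
rewrite horner_sum subr_eq0 => /eqP tra.
have {}tra : qtrace q N.+1 a = 1.
  by rewrite -tra; apply: eq_bigr => i _; rewrite map_polyXn hornerXn.
split=> //; have := qtrace_frobenius N.+1 a.
by rewrite tra expr1n => /addrI.
Qed.

(** * The T-spaces of elements with values of trace zero *)

Section TraceSpaces.
Variable A : lalgType k.

(** Ranging over all extension fields [L], with the values of [phi] confined to
the roots of ['X^(q ^ N) - 'X], avoids fixing a model of the field with [q ^ N]
elements and embeddings between these models. *)
Definition trace_space N : set A :=
  [set f | forall (L : fieldExtType k) (phi : {lrmorphism A -> L}),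
    (forall z, phi z ^+ (q ^ N) = phi z) -> qtrace q N (phi f) = 0].

Lemma trace_space_Tspace N : is_Tspace (trace_space N).
Proof.
split=> [|h _ [f Vf <-] L phi phiN]; last first.
  by apply: (Vf L (phi \o h : {lrmorphism A -> L})) => z; exact: phiN.
split=> [L phi _|c u v Vu Vv L phi phiN]; first by rewrite rmorph0 qtrace0.
by rewrite linearP qtrace_linear Vu // Vv // scaler0 addr0.
Qed.

(** The witness is [f = x (1 - c ^ (q ^ M - 1))] with [c = x ^ (q ^ N) - x] and
[M = N * d]: a value of [c] at level [M] is either zero, and then [x] takes a
value at level [N] which [f] shares, or a nonzero element of a field with
[q ^ M] elements, whose power [q ^ M - 1] is 1, and then [f] vanishes. *)
Lemma trace_spaces_comaximal p N d (x : A) :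
  p \in [pchar k] -> (p %| d)%N -> (0 < N * d)%N ->
  exists2 f, trace_space (N * d) f & trace_space N (x - f).
Proof.
move=> pk p_d Nd_gt0; set M := (N * d)%N.
have qM_gt1 : (1 < q ^ M)%N.
  by rewrite -(expn0 q) ltn_exp2l ?finNzRing_gt1.
have zeroX (L : fieldExtType k) : (0 : L) ^+ (q ^ M).-1 = 0.
  by rewrite expr0n -leqn0 leqNgt -subn1 subn_gt0 qM_gt1.
pose f := x * (1 - (x ^+ (q ^ N) - x) ^+ (q ^ M).-1).
have phif (L : fieldExtType k) (phi : {lrmorphism A -> L}) : phi f =
    phi x * (1 - (phi x ^+ (q ^ N) - phi x) ^+ (q ^ M).-1).
  by rewrite rmorphM rmorphB rmorph1 rmorphXn rmorphB rmorphXn.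
exists f => L phi phiP; last first.
  by rewrite rmorphB /= phif phiP subrr zeroX subr0 mulr1 subrr qtrace0.
rewrite phif; have [xN|nz_c] := eqVneq (phi x ^+ (q ^ N)) (phi x).
  rewrite xN subrr zeroX subr0 mulr1 qtrace_mul // -mulr_natr (_ : d%:R = 0) ?mulr0 //.
  by apply/eqP; rewrite -(dvdn_pcharf (_ : p \in [pchar L])) // pchar_lalg.
rewrite -subr_eq0 in nz_c; set c := _ - _ in nz_c *.
have cM : c ^+ (q ^ M) = c.
  rewrite /c (_ : _ - _ = phi (x ^+ (q ^ N) - x)) ?phiP //.
  by rewrite rmorphB rmorphXn.
rewrite (_ : c ^+ (q ^ M).-1 = 1) ?subrr ?mulr0 ?qtrace0 //.
by apply: (mulfI nz_c); rewrite -exprS prednK ?mulr1 // ltnW.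
Qed.

End TraceSpaces.
End FiniteBaseField.

Arguments trace_space {k} A N.

(** * Maximal T-spaces *)

(** When [x] generates everything as a T-space, a T-space is proper exactly when
it misses [x], a property that survives unions of chains. *)
Lemma maximal_Tspace_above (k : fieldType) (A : lalgType k) (x : A) (V : set A) :
  (forall W : set A, is_Tspace W -> W x -> W = setT) ->
  is_Tspace V -> ~ V x -> exists2 M : set A, is_maximal_Tspace M & V `<=` M.
Proof.
move=> xgen TV Vx.
(* Joining [V] to every member lets the empty chain, whose union is empty,
   satisfy [P]. *)
pose P (B : set A) := is_Tspace (V `|` B) /\ ~ (V `|` B) x.
have [|B [[TB Bx] maxB]] := @Zorn_bigcup _ P.
  move=> F FP Ftot.
  have chain u v : (V `|` \bigcup_(B in F) B) u -> (V `|` \bigcup_(B in F) B) v ->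
      exists B, [/\ is_Tspace (V `|` B), (V `|` B) u, (V `|` B) v &
                 V `|` B `<=` V `|` \bigcup_(B in F) B].
    have sub B : F B -> V `|` B `<=` V `|` \bigcup_(B in F) B.
      by move=> FB w [Vw|Bw]; [left | right; exists B].
    move=> [Vu|[B FB Bu]] [Vv|[C FC Cv]].
    - by exists V; rewrite setUid; split=> // w Vw; left.
    - by exists C; split; [case: (FP _ FC) | left | right | exact: sub].
    - by exists B; split; [case: (FP _ FB) | right | left | exact: sub].
    - have [BC|CB] := Ftot _ _ FB FC.
      + by exists C; split; [case: (FP _ FC) | right; exact: BC | right | exact: sub].
      + by exists B; split; [case: (FP _ FB) | right | right; exact: CB | exact: sub].
  split; last by case=> // -[B FB Bx]; case: (FP _ FB) => _; apply; right.
  split; first split=> [|c u v Uu Uv].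
  - by left; case: TV => [[]].
  - have [B [[[_ linB] _] Bu Bv sub]] := chain _ _ Uu Uv.
    by apply: sub; exact: linB.
  - move=> h _ [f Uf <-]; have [B [[_ endB] Bf _ sub]] := chain _ _ Uf Uf.
    by apply: sub; apply: (endB h); exists f.
exists (V `|` B); last by move=> f Vf; left.
split=> // [eqT|W TW WT VBW]; first by apply: Bx; rewrite eqT.
have [//|neqW] := pselect (W = V `|` B).
have PW : P W.
  have -> : P W = (is_Tspace W /\ ~ W x).
    by rewrite /P setUidr // => f Vf; apply: VBW; left.
  by split=> // Wx; apply: WT; exact: xgen.
case: (maxB W) => //; split=> [f Bf|WB]; first by apply: VBW; right.
by apply: neqW; apply/seteqP; split=> // f Wf; right; exact: WB.
Qed.

(** * Evaluation of the free algebra *)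

Section FreeAlgebra.
Context {X : choiceType} {k : fieldType}.
Local Notation gen i := (<< fmu i >> : free_algebra k X).

Lemma free_algebra_scalerAr (c : k) (u v : free_algebra k X) :
  u * (c *: v) = c *: (u * v).
Proof.
apply/malgP => m; rewrite mcoeffZ.
rewrite (mcoeffMlw _ (fsubset_refl _) (msuppZ_le c v)) mcoeffMl big_distrr /=.
apply: eq_bigr => i _; rewrite big_distrr /=; apply: eq_bigr => j _.
by rewrite mcoeffZ mulrCA mulrnAr.
Qed.

(** Sending all variables to the same element is enough both to reach an
arbitrary target from one variable and to evaluate in a field.  Since [b]
commutes with its powers, [B] need not be commutative: evaluation is
multiplicative as soon as the scalars are central, which covers both a field
and the free algebra itself. *)
Lemma free_algebra_eval (B : lalgType k) (b : B) :
  (forall (c : k) (u v : B), u * (c *: v) = c *: (u * v)) ->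
  exists2 phi : {lrmorphism free_algebra k X -> B},
    (forall i, phi (gen i) = b) &
    forall z, phi z = \sum_(m <- msupp z) z@_m *: b ^+ fdeg m.
Proof.
move=> scalAr.
pose h (m : {fmonom X}) := b ^+ fdeg m.
have hM : mmorphism h.
  by split=> [m1 m2|]; rewrite /h ?fdeg1 ?expr0 // fdegM exprD.
pose hI := isMultiplicative.Build _ _ h hM.
pose H : {mmorphism {fmonom X} -> B} := HB.pack h hI.
pose e : free_algebra k X -> B := mmap (in_alg B) H.
have eM : multiplicative e.
  apply: commr_mmap_is_multiplicative => g m m'.
  by rewrite /GRing.comm /= scalAr mulr1 mulr_algl.
have eZ : scalable e by move=> c g; rewrite /e mmapZ /= mulr_algl.
pose eA := GRing.isAdditive.Build _ _ e (@mmap_is_additive _ _ _ (in_alg B) H).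
pose eMI := GRing.isMultiplicative.Build _ _ e eM.
pose eZI := GRing.isScalable.Build _ _ _ _ e eZ.
pose phi : {lrmorphism free_algebra k X -> B} := HB.pack e eA eMI eZI.
exists phi => [i|z]; last first.
  by rewrite /= /e mmapE; apply: eq_bigr => m _; rewrite /= mulr_algl.
by rewrite /= /e mmapU /= scale1r mul1r /h fdegU expr1.
Qed.

Lemma Tspace_gen (W : set (free_algebra k X)) i :
  is_Tspace W -> W (gen i) -> W = setT.
Proof.
move=> [_ endW] Wi; apply/seteqP; split=> // g _.
have [phi phi_gen _] := free_algebra_eval g free_algebra_scalerAr.
by apply: (endW phi); exists (gen i).
Qed.

End FreeAlgebra.

Lemma gen_notin_trace_space (X : choiceType) (k : finFieldType) (i : X) N :
  (0 < N)%N -> ~ trace_space (free_algebra k X) N << fmu i >>.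
Proof.
move=> N_gt0; have [L [a [aN tra]]] := qtrace1_witness k N_gt0.
have scalAr c (u v : L) : u * (c *: v) = c *: (u * v) by rewrite scalerAr.
have [phi phi_gen phiE] := free_algebra_eval (X := X) a scalAr.
move=> /(_ L phi); rewrite phi_gen tra => tr0.
suff /tr0/eqP : forall z, phi z ^+ (#|k| ^ N) = phi z by rewrite oner_eq0.
move=> z; rewrite phiE (big_morph _ (@frobeniusD k L N) (frobenius0 L N)).
by apply: eq_bigr => m _; rewrite frobeniusZ -exprM mulnC exprM aN.
Qed.

(** * Infinitely many maximal T-spaces *)

Theorem infinite_maximal_Tspaces (X : choiceType) (k : finFieldType) :
  inhabited X ->
  infinite_set [set V : set (free_algebra k X) | is_maximal_Tspace V].
Proof.
move=> [i]; have [p p_pr pk] := finPcharP k.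
pose x : free_algebra k X := << fmu i >>.
pose V n := trace_space (free_algebra k X) (p ^ n).
have x_gen W : is_Tspace W -> W x -> W = setT by exact: Tspace_gen.
have pX_gt0 n : (0 < p ^ n)%N by rewrite expn_gt0 prime_gt0.
have /choice[M MP] n : exists M, is_maximal_Tspace M /\ V n `<=` M.
  have Vx : ~ V n x := gen_notin_trace_space (pX_gt0 n).
  have [M] := maximal_Tspace_above x_gen (trace_space_Tspace _ _) Vx.
  by exists M.
have M_lt n m : (n < m)%N -> M n <> M m.
  move=> n_lt_m eqM.
  have Dm : (p ^ m = p ^ n * p ^ (m - n))%N by rewrite -expnD subnKC // ltnW.
  have [||f Vf Vxf] := trace_spaces_comaximal (N := p ^ n) (d := p ^ (m - n)) x pk.
  - by rewrite dvdn_exp ?subn_gt0.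
  - by rewrite -Dm.
  have [maxM VM] := MP m.
  have Mf : M m f by apply: VM; rewrite /V Dm.
  have Mxf : M m (x - f) by rewrite -eqM; apply: (MP n).2.
  have [TM properM _] := maxM; have [[_ linM] _] := TM.
  apply: properM; apply: x_gen TM _.
  by have := linM 1 _ _ Mxf Mf; rewrite scale1r subrK.
have M_inj : injective M.
  by move=> n m eqM; case: (ltngtP n m) => // /M_lt []; rewrite eqM.
move=> finM; apply: infinite_nat.
rewrite (_ : setT = M @^-1` [set W | is_maximal_Tspace W]).
  by apply: finite_preimage finM => n m _ _; exact: M_inj.
by apply/seteqP; split=> // n _; case: (MP n).
Qed.

Theorem corollary6p2 (X : choiceType) (k : finFieldType) :
  inhabited X -> 2%N \in [pchar k]%R ->
  infinite_set [set V : set (free_algebra k X) | is_maximal_Tspace V].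
Proof. by move=> inhX _; exact: infinite_maximal_Tspaces. Qed.
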